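(* Let $A=(a_{ij})_{n\times n}$ be a real matrix of order $n$ and let $E=\{(i_l,j_l)\mid 1\le l\le k\}$ be a non-empty set of $k$ distinct pairs in $[n]\times[n]$ with $i_1\le i_2\le\cdots\le i_k$ and $a_{i_lj_l}\neq 0$ for all $l\in[k]$. Then for any fixed $p\in[k]$, $$\det(E[A])\det(A)=\det(E_p[A])\det(\overline{E_p}[A])-\sum_{1\le l\le k,\ l\ne p}(-1)^{i_l+j_l+i_p+j_p}\,a_{i_pj_p}\,a_{i_lj_l}\,\det(E[A]_{i_pj_l})\,\det(A_{i_lj_p}),$$ where $E_p=E\setminus\{(i_p,j_p)\}$ and $\overline{E_p}=\{(i_p,j_p)\}$.
   Context: $[n]=\{1,\ldots,n\}$. For a set $E\subseteq[n]\times[n]$, $E[A]$ denotes the $n\times n$ matrix obtained from $A$ by replacing the $(s,t)$-entry by $0$ for every $(s,t)\in E$ and leaving all other entries unchanged (so $E[A]=A$ if $E=\emptyset$). For a square matrix $B$, $B_{ij}$ denotes the matrix obtained from $B$ by deleting the $i$-th row and the $j$-th column; $E[A]_{ij}$ means $(E[A])_{ij}$. *)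

(* Defs.v *)
From HB Require Import structures.
From mathcomp Require Import all_boot all_order all_algebra.
From mathcomp Require Import reals.

Set Implicit Arguments.
Unset Strict Implicit.
Unset Printing Implicit Defensive.

Import GRing.Theory.

Local Open Scope ring_scope.

(* E[A] *)
Definition zero_entries (R : nzRingType) (n : nat)
    (E : {set 'I_n * 'I_n}) (A : 'M[R]_n) : 'M[R]_n :=
  \matrix_(s, t) (if (s, t) \in E then 0 else A s t).

(* B_{ij} *)
Definition del_row_col (R : nzRingType) (n : nat)
    (i j : 'I_n) (B : 'M[R]_n) : 'M[R]_n.-1 :=
  row' i (col' j B).

(* Main.v *)
(* Expand [\adj A *m (A - E[A]) *m \adj E[A]] at entry [(j_p, i_p)] in two ways:
   directly, as a sum over the entries in [E], and through the adjugate
   identities, as [\det A * \adj E[A] - \det E[A] * \adj A].  Moreover [E_p[A]]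
   and [\overline{E_p}[A]] differ from [E[A]] and [A] in a single entry, so their
   determinants differ by a multiple of one cofactor. *)

Require Import Defs.
From HB Require Import structures.
From mathcomp Require Import all_boot all_order all_algebra.
From mathcomp Require Import reals.
From mathcomp Require Import ring.

Set Implicit Arguments.
Unset Strict Implicit.
Unset Printing Implicit Defensive.

Import GRing.Theory.

Local Open Scope ring_scope.

(** Laplace expansion along row [i]: its cofactors delete that row, so they do not see the
    perturbation. *)
Lemma det_add_delta (R : comNzRingType) (n : nat) (A : 'M[R]_n)
    (i j : 'I_n) (a : R) :
  \det (A + a *: delta_mx i j) = \det A + a * cofactor A i j.
Proof.
have eq_cof t : cofactor (A + a *: delta_mx i j) i t = cofactor A i t.
  congr (_ * \det _); apply/matrixP=> x y; rewrite !mxE.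
  by rewrite eq_sym (negPf (neq_lift _ _)) mulr0 addr0.
rewrite (expand_det_row _ i) (expand_det_row A i).
rewrite (bigD1 j) //= [in RHS](bigD1 j) //= eq_cof !mxE !eqxx mulr1.
rewrite mulrDl -!addrA; congr (_ + _); rewrite addrC; congr (_ + _).
apply: eq_bigr => t /negPf t_neq_j.
by rewrite eq_cof !mxE t_neq_j andbF mulr0 addr0.
Qed.

Lemma zero_entriesD1 (R : nzRingType) (n : nat) (A : 'M[R]_n)
    (E : {set 'I_n * 'I_n}) (i j : 'I_n) :
  (i, j) \in E ->
  zero_entries (E :\ (i, j)) A = zero_entries E A + A i j *: delta_mx i j.
Proof.
move=> ijE; apply/matrixP=> s t; rewrite !mxE !inE -xpair_eqE.
by case: eqP => [[-> ->]|_]; rewrite /= ?ijE ?mulr1 ?add0r ?mulr0 ?addr0.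
Qed.

Lemma zero_entries1 (R : nzRingType) (n : nat) (A : 'M[R]_n) (i j : 'I_n) :
  zero_entries [set (i, j)] A = A + (- A i j) *: delta_mx i j.
Proof.
apply/matrixP=> s t; rewrite !mxE !inE -xpair_eqE.
by case: eqP => [[-> ->]|_]; rewrite /= ?mulr1 ?subrr ?mulr0 ?addr0.
Qed.

Lemma sum_cofactor_zero_entries (R : comNzRingType) (n : nat) (A : 'M[R]_n)
    (E : {set 'I_n * 'I_n}) (i j : 'I_n) :
  \sum_(e in E) A e.1 e.2 * cofactor (zero_entries E A) i e.2
                          * cofactor A e.1 j =
  \det A * cofactor (zero_entries E A) i j
  - \det (zero_entries E A) * cofactor A i j.
Proof.
set B := zero_entries E A.
have adjE : \adj A *m (A - B) *m \adj B = \det A *: \adj B - \det B *: \adj A.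
  rewrite mulmxBr mulmxBl mul_adj_mx mul_scalar_mx.
  by rewrite -[_ *m B *m _]mulmxA mul_mx_adj mul_mx_scalar.
have /matrixP/(_ j i) := adjE; rewrite !mxE => <-.
under [RHS]eq_bigr do rewrite mxE mulr_suml.
(* The double sum runs over all pairs, but [A - B] vanishes off [E] and agrees with [A] on [E]. *)
rewrite exchange_big pair_big /= big_mkcond /=; apply: eq_bigr => -[s t] _ /=.
rewrite !mxE; case: ifP => _; last by rewrite subrr mulr0 mul0r.
by rewrite subr0 mulrC mulrA.
Qed.

(* Rows and columns are numbered from 0; each sign exponent is a sum of four
   indices, so its parity is the same as with the numbering from 1. *)
Theorem theorem4p2 (R : realType) (n : nat) (A : 'M[R]_n)
    (k : nat) (i j : 'I_k -> 'I_n) (E : {set 'I_n * 'I_n})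
    (E_def : E = [set (i l, j l) | l : 'I_k])
    (E_neq0 : E != set0)
    (ij_inj : injective (fun l : 'I_k => (i l, j l)))
    (i_sorted : forall l m : 'I_k, (l <= m)%N -> (i l <= i m)%N)
    (A_neq0 : forall l : 'I_k, A (i l) (j l) != 0)
    (p : 'I_k) :
  let Ep := E :\ (i p, j p) in
  let Ep_bar := [set (i p, j p)] in
  \det (zero_entries E A) * \det A =
    \det (zero_entries Ep A) * \det (zero_entries Ep_bar A)
    - \sum_(l < k | l != p)
        (-1) ^+ (i l + j l + i p + j p) * A (i p) (j p) * A (i l) (j l)
        * \det (del_row_col (i p) (j l) (zero_entries E A))
        * \det (del_row_col (i l) (j p) A).
Proof.
move=> Ep Ep_bar.
have pE : (i p, j p) \in E by rewrite E_def imset_f.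
rewrite /Ep /Ep_bar zero_entriesD1 // zero_entries1 !det_add_delta.
set B := zero_entries E A.
have := sum_cofactor_zero_entries A E (i p) (j p).
(* Distinctness of the pairs turns the sum over [E] into a sum over [l]. *)
rewrite -/B {1}E_def big_imset /=; last by move=> l m _ _ /ij_inj.
rewrite (bigD1 p) //= => sumE.
(* The sign of each summand is the product of the signs of its two cofactors. *)
rewrite (eq_bigr (fun l => A (i p) (j p) * (A (i l) (j l)
    * cofactor B (i p) (j l) * cofactor A (i l) (j p)))); last first.
  move=> l _; rewrite /cofactor /del_row_col.
  by rewrite !exprD; ring.
rewrite -mulr_sumr.
set S := \sum_(l | _) _ in sumE *.
(* Isolating the term [l = p] leaves a product of two cofactors at [(i p, j p)]; it cancels the
   quadratic term from multiplying the two one-entry expansions. *)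
have -> : S = \det A * cofactor B (i p) (j p) - \det B * cofactor A (i p) (j p)
    - A (i p) (j p) * cofactor B (i p) (j p) * cofactor A (i p) (j p).
  by rewrite -sumE addrAC subrr add0r.
ring.
Qed.
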